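(* For any $s\in(0,1)$ and any $\alpha\in(0,+\infty)$, the maximum principle does not hold for the operator $-\Delta-\alpha(-\Delta)^s$. More precisely, with $\Omega:=(-1,1)\subset\mathbb{R}$, there exists a function $u:\mathbb{R}\to\mathbb{R}$ such that $u\in C(\mathbb{R})\cap C^2(\Omega)$, $$-\Delta u-\alpha(-\Delta)^su\ge0\ \text{ in }\Omega\qquad\text{and}\qquad u\ge0\ \text{ in }\mathbb{R}\setminus\Omega,$$ but $u(x)<0$ for any $x\in\Omega$.
   Context: Here the dimension is $N=1$, $\Delta u=u''$, and for $s\in(0,1)$ the fractional Laplacian is the pointwise operator $$(-\Delta)^su(x):=c_{1,s}\int_{\mathbb{R}}\frac{2u(x)-u(x+y)-u(x-y)}{|y|^{1+2s}}\,dy,\qquad c_{1,s}:=\frac{2^{2s-1}\,\Gamma\left(\frac{1+2s}{2}\right)}{\pi^{1/2}\,\Gamma(2-s)}\,s(1-s)>0,$$ with $\Gamma$ the Gamma function. The statement includes that this integral is well defined (absolutely convergent) for the function $u$ at every $x\in\Omega$. *)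

(* Defs.v *)
From mathcomp Require Export all_boot all_order all_algebra.
From mathcomp Require Export all_classical all_reals all_analysis.

Set Implicit Arguments.
Unset Strict Implicit.
Unset Printing Implicit Defensive.

Import Order.TTheory GRing.Theory Num.Theory.
Import numFieldNormedType.Exports.

Local Open Scope classical_set_scope.
Local Open Scope ring_scope.

(* Euler's integral; meaningful for 0 < z, the only case used. *)
Definition Gamma {R : realType} (z : R) : R :=
  \int[lebesgue_measure]_(t in `]0, +oo[) (t `^ (z - 1) * expR (- t)).

Definition cfrac {R : realType} (s : R) : R :=
  2 `^ (2 * s - 1) * Gamma ((1 + 2 * s) / 2) / (pi `^ (2^-1) * Gamma (2 - s))
  * (s * (1 - s)).

(* At y = 0 the denominator is 0 and the quotient is 0 by convention; a single
   point does not affect the integral. *)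
Definition fracLap_integrand {R : realType} (s : R) (u : R -> R) (x y : R) : R :=
  (2 * u x - u (x + y) - u (x - y)) / (`|y| `^ (1 + 2 * s)).

(* [Rintegral] is total, so this is the fractional
   Laplacian only where [fracLap_defined] below holds. *)
Definition fracLap {R : realType} (s : R) (u : R -> R) (x : R) : R :=
  cfrac s * \int[lebesgue_measure]_(y in [set: R]) fracLap_integrand s u x y.

(* Absolute convergence of the integral over the whole line. *)
Definition fracLap_defined {R : realType} (s : R) (u : R -> R) (x : R) : Prop :=
  (@lebesgue_measure R).-integrable [set: R]
    (fun y => (fracLap_integrand s u x y)%:E).

(* Class C^2 on an open set A: derivatives at a point of A depend only on u near
   that point, so the total functions [derive1 u] and [derive1n 2 u] may be used
   without restricting them to A. *)
Definition C2_on {R : realType} (A : set R) (u : R -> R) : Prop :=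
  forall x, A x ->
    [/\ derivable u x 1, derivable (derive1 u) x 1
      & {for x, continuous (derive1n 2 u)}].

(* Main.v *)
(* Take u(x) = min(x^2, K^2) - 1.  For |x| < 1 one has u''(x) = 2 whatever K is,
   while N(y) = u(x+y) + u(x-y) - 2 u(x) satisfies 0 <= N(y) <= 2 min(y^2, K^2)
   for all y, with N(y) = 2 y^2 when |y| <= K - 1.  Hence the integral defining
   (-Delta)^s u(x) converges and is at most -C K^(2-2s), uniformly in x: for K
   large the nonlocal term beats the local one.  The constant c_{1,s} must be
   known to be positive, i.e. the Gamma integrals in it must converge. *)
Require Import Defs.
From mathcomp Require Import measurable_realfun lra ring.

Import Order.TTheory GRing.Theory Num.Theory.
Import numFieldNormedType.Exports.
Local Open Scope classical_set_scope.
Local Open Scope ring_scope.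

Set Implicit Arguments.
Unset Strict Implicit.

(** * Power integrals and tools for integrability and lower bounds *)

Lemma powR_continuous (R : realType) (p x : R) :
  0 < x -> {for x, continuous (fun t : R => t `^ p)}.
Proof.
move=> x0; apply: differentiable_continuous; apply/derivable1_diffP.
by apply: derivable_powR; rewrite in_itv/= x0.
Qed.

Lemma is_derive_powR_div (R : realType) (p x : R) : p != 0 -> 0 < x ->
  is_derive x 1 (fun t : R => t `^ p / p) (x `^ (p - 1)).
Proof.
move=> p0 x0; have h := is_derive1_powR p x0.
have -> : (fun t : R => t `^ p / p) = p^-1 \*: (fun t : R => t `^ p).
  by apply/funext => t; rewrite mulrC.
apply: is_derive_eq.
by rewrite scalerA mulVf// scale1r.
Qed.

(** The antiderivative is [x^p / p]. Allowing negative [p] lets one formula serve both the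
    singularity at 0 and the tail at infinity. *)
Lemma integral_powR_itv (R : realType) (p a b : R) : p != 0 -> 0 < a -> a < b ->
  (\int[lebesgue_measure]_(x in `[a, b]) (x `^ (p - 1))%:E
    = (b `^ p / p)%:E - (a `^ p / p)%:E)%E.
Proof.
move=> p0 a0 ab.
have cF x : 0 < x -> {for x, continuous (fun t : R => t `^ p / p)}.
  move=> x0; apply: differentiable_continuous; apply/derivable1_diffP.
  by have [] := is_derive_powR_div p0 x0.
rewrite (@continuous_FTC2 _ _ (fun t : R => t `^ p / p))//.
- apply: continuous_in_subspaceT => x; rewrite inE/= in_itv/= => /andP[ax _].
  by apply: powR_continuous; exact: lt_le_trans ax.
- split.
  + move=> x; rewrite in_itv/= => /andP[ax _].
    by have [] := is_derive_powR_div p0 (lt_trans a0 ax).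
  + exact/cvg_at_right_filter/cF.
  + exact/cvg_at_left_filter/cF/(lt_trans a0).
- move=> x; rewrite in_itv/= => /andP[ax _].
  have [_ <-] := is_derive_powR_div p0 (lt_trans a0 ax).
  by rewrite derive1E.
Qed.

(** Monotone convergence along an exhaustion: it turns uniform bounds on compact intervals, where
    the fundamental theorem of calculus applies, into bounds for improper integrals. *)
Lemma ge0_bigcup_integral_le d (T : measurableType d) (R : realType)
    (mu : {measure set T -> \bar R}) (F : (set T)^nat) (f : T -> R) (C : \bar R) :
  nondecreasing_seq F -> (forall n, measurable (F n)) ->
  measurable_fun setT f -> (forall x, 0 <= f x) ->
  (forall n, \int[mu]_(x in F n) (f x)%:E <= C)%E ->
  (\int[mu]_(x in \bigcup_n F n) (f x)%:E <= C)%E.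
Proof.
move=> ndF mF mf f0 le_C.
have cvgF : (\int[mu]_(x in F n) (f x)%:E @[n --> \oo] -->
    \int[mu]_(x in \bigcup_n F n) (f x)%:E)%E.
  apply: ge0_nondecreasing_set_cvg_integral => // [n|n x _].
    by apply/measurable_EFinP; exact: measurable_funTS.
  by rewrite lee_fin.
rewrite -(cvg_lim _ cvgF)//; apply: lime_le; first exact: (cvgP _ cvgF).
exact: nearW.
Qed.

(** Exhaustion by [[1/(n+2), 1]]; the shift by 2 keeps every interval nondegenerate. The boundary
    term at the lower endpoint has a favourable sign and is dropped, so only an inequality is
    obtained. *)
Lemma integral_powR_oc01 (R : realType) (p : R) : 0 < p ->
  (\int[lebesgue_measure]_(x in `]0%R, 1%R]) (x `^ (p - 1))%:E <= (p^-1)%:E)%E.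
Proof.
move=> p0; pose F (n : nat) : set R := `[(n.+2%:R)^-1, 1]%classic.
have -> : `]0%R, 1%R]%classic = \bigcup_n F n.
  apply/seteqP; split => x /=.
    rewrite in_itv/= => /andP[x0 x1].
    exists (Num.truncn x^-1) => //; rewrite /F/= in_itv/= x1 andbT.
    rewrite invf_ple ?posrE//; apply: ltW.
    by apply: lt_trans (truncnS_gt _) _; rewrite ltr_nat.
  move=> [n _]; rewrite /F/= !in_itv/= => /andP[nx ->]; rewrite andbT.
  by apply: lt_le_trans nx; rewrite invr_gt0.
apply: ge0_bigcup_integral_le => [|n||x|n].
- apply/nondecreasing_seqP => n; rewrite subsetEset => x; rewrite /F/= !in_itv/=.
  move=> /andP[h ->]; rewrite andbT; apply: le_trans h.
  by rewrite lef_pV2 ?posrE// ler_nat.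
- exact: measurable_itv.
- exact: measurable_powR.
- exact: powR_ge0.
- rewrite integral_powR_itv ?gt_eqF ?invr_gt0 ?invf_lt1 ?ltr1n//.
  rewrite powR1 div1r -EFinB lee_fin lerBlDr lerDl.
  by rewrite divr_ge0 ?powR_ge0// ltW.
Qed.

Lemma integral_powR_cy1 (R : realType) (q : R) : 0 < q ->
  (\int[lebesgue_measure]_(x in `[1%R, +oo[) (x `^ (- q - 1))%:E <= (q^-1)%:E)%E.
Proof.
move=> q0; pose F (n : nat) : set R := `[1, n.+2%:R]%classic.
have -> : `[1%R, +oo[%classic = \bigcup_n F n.
  apply/seteqP; split => x /=.
    rewrite in_itv/= andbT => x1.
    exists (Num.truncn x) => //; rewrite /F/= in_itv/= x1/=; apply: ltW.
    by apply: lt_trans (truncnS_gt _) _; rewrite ltr_nat.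
  by move=> [n _]; rewrite /F/= !in_itv/= => /andP[-> _].
apply: ge0_bigcup_integral_le => [|n||x|n].
- apply/nondecreasing_seqP => n; rewrite subsetEset => x; rewrite /F/= !in_itv/=.
  by move=> /andP[-> h]/=; apply: le_trans h _; rewrite ler_nat.
- exact: measurable_itv.
- exact: measurable_powR.
- exact: powR_ge0.
- rewrite integral_powR_itv ?oppr_eq0 ?gt_eqF ?ltr1n//.
  rewrite powR1 -EFinB lee_fin !invrN !mulrN mul1r opprK gerDr.
  by rewrite oppr_le0 divr_ge0 ?powR_ge0// ltW.
Qed.

(** Comparison criterion with separate powers on the two sides of 1. It serves both the Gamma
    integrand and the singular kernel of the fractional Laplacian. *)
Lemma integrable_powR_dominated (R : realType) (p q C : R) (f : R -> R) :
  0 < p -> 0 < q -> measurable_fun setT f ->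
  (forall t, 0 < t <= 1 -> `|f t| <= C * t `^ (p - 1)) ->
  (forall t, 1 <= t -> `|f t| <= C * t `^ (- q - 1)) ->
  lebesgue_measure.-integrable `]0, +oo[ (EFin \o f).
Proof.
move=> p0 q0 mf f01 f1y.
have C0 : 0 <= C.
  by have := f1y 1 (lexx _); rewrite powR1 mulr1; apply: le_trans.
have mfD (D : set R) : measurable_fun D (fun x => `|f x|%:E).
  by apply/measurable_EFinP/measurableT_comp => //; exact: measurable_funTS.
apply/integrableP; split; first by apply/measurable_EFinP; exact: measurable_funTS.
have -> : `]0, +oo[%classic = `]0, 1]%classic `|` `]1, +oo[%classic :> set R.
  by rewrite -itv_bndbnd_setU// bnd_simp.
rewrite ge0_integral_setU//=; [|exact: mfD|]; last first.
  rewrite disj_set2E; apply/eqP/seteqP; split => // x /=.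
  rewrite !in_itv/= andbT => -[/andP[_ x1] x2].
  by move: (lt_le_trans x2 x1); rewrite ltxx.
have bnd (D : set R) (r K : R) : measurable D ->
    (forall t, D t -> `|f t| <= C * t `^ r) ->
    (\int[lebesgue_measure]_(x in D) (x `^ r)%:E <= K%:E)%E ->
    (\int[lebesgue_measure]_(x in D) `|f x|%:E < +oo)%E.
  move=> mD fD DK.
  have mr : measurable_fun D (EFin \o (fun x : R => x `^ r)).
    by apply/measurable_EFinP; apply: measurable_funTS; exact: measurable_powR.
  apply: (@le_lt_trans _ _ (C%:E * K%:E)%E); last by rewrite -EFinM ltry.
  apply: le_trans (lee_wpmul2l _ DK); last by rewrite lee_fin.
  rewrite -ge0_integralZl//=; last by move=> x _; rewrite lee_fin powR_ge0.
  apply: ge0_le_integral => //=.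
  - exact: mfD.
  - by apply: emeasurable_funM => //; exact: measurable_cst.
apply: lte_add_pinfty.
  by apply: bnd (integral_powR_oc01 p0) => // t /=; rewrite in_itv; exact: f01.
apply: bnd (le_trans _ (integral_powR_cy1 q0)) => //.
  by move=> t /=; rewrite in_itv/= andbT => /ltW; exact: f1y.
(* The split leaves []1, +oo[], while the tail bound is stated on [[1, +oo[]. *)
apply: ge0_subset_integral => //.
- by apply/measurable_EFinP; apply: measurable_funTS; exact: measurable_powR.
- by move=> x _; rewrite lee_fin powR_ge0.
- by move=> x /=; rewrite !in_itv/= !andbT; exact: ltW.
Qed.

Lemma even_integrable_setT (R : realType) (f : R -> R) :
  measurable_fun setT f -> (forall x, f (- x) = f x) ->
  lebesgue_measure.-integrable `]0, +oo[ (EFin \o f) ->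
  lebesgue_measure.-integrable setT (EFin \o f).
Proof.
move=> mf fN /integrableP[_ fy]; apply/integrableP; split; first exact/measurable_EFinP.
have mfD (D : set R) : measurable_fun D (fun x => `|f x|%:E).
  by apply/measurable_EFinP/measurableT_comp => //; exact: measurable_funTS.
have -> : [set: R] = `]-oo, 0]%classic `|` `]0, +oo[%classic.
  by rewrite -itv_bndbnd_setU// set_itvNyy.
rewrite ge0_integral_setU//=; [|exact: mfD|]; last first.
  rewrite disj_set2E; apply/eqP/seteqP; split => // x /=.
  rewrite !in_itv/= andbT => -[x1 x2].
  by move: (lt_le_trans x2 x1); rewrite ltxx.
apply: lte_add_pinfty => //.
(* Writing the integrand at [- x] prepares the reflection onto the positive half-line; the endpoint
   0 is then removed as a null set. *)
under eq_integral do rewrite -fN.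
rewrite -(@ge0_integration_by_substitution0 R (fun x => `|f x|%:E))//.
by rewrite -integral_itv_obnd_cbnd.
Qed.

(** Rectangle bound, used for the positivity of Gamma and for the size of the nonlocal term. *)
Lemma Rintegral_ge_cst_itv (R : realType) (f : R -> R) (D : set R) (a b c : R) :
  measurable D -> a <= b -> `[a, b] `<=` D ->
  lebesgue_measure.-integrable D (EFin \o f) -> (forall x, D x -> 0 <= f x) ->
  0 <= c -> (forall x, a <= x <= b -> c <= f x) ->
  c * (b - a) <= \int[lebesgue_measure]_(x in D) f x.
Proof.
move=> mD ab abD fi f0 c0 fc.
have mf : measurable_fun D (EFin \o f) by exact: measurable_int fi.
rewrite -lee_fin /Rintegral fineK; last exact: integrable_fin_num.
apply: (@le_trans _ _ (\int[lebesgue_measure]_(x in `[a, b]) (f x)%:E)%E); last first.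
  by apply: ge0_subset_integral => // x Dx; rewrite lee_fin f0.
have -> : (c * (b - a))%:E = (\int[lebesgue_measure]_(x in `[a, b]) (cst c%:E x))%E.
  rewrite integral_cst//= lebesgue_measure_itv/= lte_fin EFinM.
  by case: ltgtP ab => // <- _; rewrite subrr.
by apply: ge0_le_integral => //; exact: measurable_funS mf.
Qed.

(** * Positivity of the normalizing constant *)

(* For [z <= 2] the integrand is at most [27 t^-2] because [(1 + t/3)^3 <= exp t]. *)
Lemma Gamma_gt0 (R : realType) (z : R) : 0 < z -> z <= 2 -> 0 < Gamma z.
Proof.
move=> z0 z2.
pose f (t : R) := t `^ (z - 1) * expR (- t).
have f0 t : 0 <= f t by rewrite mulr_ge0 ?powR_ge0 ?expR_ge0.
have mf : measurable_fun setT f.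
  apply: measurable_funM; first exact: measurable_powR.
  by apply: measurableT_comp => //; exact: measurable_expR.
have fi : lebesgue_measure.-integrable `]0, +oo[ (EFin \o f).
  apply: (@integrable_powR_dominated _ z 1 27) => // t.
    move=> /andP[t0 t1]; rewrite ger0_norm// /f mulrC ler_wpM2r ?powR_ge0//.
    by apply: (@le_trans _ _ 1); [rewrite -expR0 ler_expR oppr_le0 ltW|rewrite ler1n].
  move=> t1; have t0 : 0 < t by exact: lt_le_trans t1.
  rewrite ger0_norm// /f expRN ler_pdivrMr ?expR_gt0//.
  have -> : -1 - 1 = - 2%:R :> R by rewrite -opprD.
  rewrite powRN powR_mulrn ?(ltW t0)// mulrAC ler_pdivlMr ?exprn_gt0//.
  (* Since [z - 1 <= 1] and [t >= 1], the power [t^(z-1)] is at most [t]; what remains is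
     [t^3 <= 27 exp t]. *)
  apply: (@le_trans _ _ (t ^+ 3)).
    rewrite [leRHS]exprS ler_wpM2r ?exprn_ge0 ?(ltW t0)//.
    by rewrite -[leRHS]powRr1 ?(ltW t0)// ler_powR// lerBlDr.
  have -> : expR t = expR (t / 3) ^+ 3.
    by rewrite -expRM_natl; congr expR; field.
  have h : t / 3 <= expR (t / 3).
    by apply: le_trans (expR_ge1Dx _); rewrite lerDr.
  have -> : t ^+ 3 = 27 * (t / 3) ^+ 3 by field.
  rewrite ler_wpM2l// ler_pXn2r ?nnegrE ?expR_ge0//.
  by rewrite divr_ge0 ?(ltW t0).
rewrite /Gamma.
(* On [[1, 2]] one has [x^(z-1) >= 1/x >= 1/2] because [z > 0], and [exp(-x) >= exp(-2)]; the window
   has length 1. *)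
have c0 : 0 < (2^-1 : R) * expR (- 2) by rewrite mulr_gt0 ?expR_gt0 ?invr_gt0.
apply: lt_le_trans c0 _.
have h := @Rintegral_ge_cst_itv R f `]0, +oo[ 1 2 (2^-1 * expR (- 2)).
rewrite -[leLHS]mulr1 -[X in _ * X](_ : 2 - 1 = 1); last by ring.
apply: h => //.
- by rewrite ler1n.
- by move=> x /=; rewrite !in_itv/= andbT => /andP[x1 _]; exact: lt_le_trans x1.
- move=> x /andP[x1 x2]; have x0 : 0 < x by exact: lt_le_trans x1.
  apply: ler_pM; rewrite ?expR_ge0 ?invr_ge0//; last by rewrite ler_expR lerN2.
  apply: (@le_trans _ _ (x `^ (- 1))).
    by rewrite powR_inv1 ?(ltW x0)// lef_pV2 ?posrE.
  by rewrite ler_powR// lerDr ltW.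
Qed.

(** Both Gamma arguments, [(1 + 2s)/2] and [2 - s], lie in [(0, 2]], the range covered by
    [Gamma_gt0]. *)
Lemma cfrac_gt0 (R : realType) (s : R) : 0 < s -> s < 1 -> 0 < cfrac s.
Proof.
move=> s0 s1; rewrite /cfrac.
have G1 : 0 < Gamma ((1 + 2 * s) / 2) by apply: Gamma_gt0; lra.
have G2 : 0 < Gamma (2 - s) by apply: Gamma_gt0; lra.
have p0 : 0 < (pi : R) `^ 2^-1 by rewrite powR_gt0// pi_gt0.
have s10 : 0 < 1 - s by lra.
by apply: mulr_gt0; [apply: divr_gt0; apply: mulr_gt0 => //; exact: powR_gt0|exact: mulr_gt0].
Qed.

(** * The truncated parabola: sign and regularity *)

Definition truncated_parabola (R : realType) (K : R) (x : R) : R :=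
  Num.min (x ^+ 2) (K ^+ 2) - 1.

Lemma truncated_parabolaE (R : realType) (K x : R) : 1 <= K -> -1 < x < 1 ->
  truncated_parabola K x = x ^+ 2 - 1.
Proof.
move=> K1 /andP[x1 x2]; congr (_ - 1); apply/min_idPl; nra.
Qed.

Lemma truncated_parabola_continuous (R : realType) (K : R) :
  continuous (truncated_parabola K).
Proof.
move=> x; apply: cvgB; last exact: cvg_cst.
apply: (@continuous_min _ _ (fun x : R => x ^+ 2) (cst (K ^+ 2))).
  exact: exprn_continuous.
exact: cvg_cst.
Qed.

Lemma truncated_parabola_lt0 (R : realType) (K x : R) : 1 <= K -> -1 < x < 1 ->
  truncated_parabola K x < 0.
Proof. by move=> K1 x1; rewrite truncated_parabolaE//; case/andP: x1 => *; nra. Qed.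

Lemma truncated_parabola_ge0 (R : realType) (K x : R) : 1 <= K -> ~~ (-1 < x < 1) ->
  0 <= truncated_parabola K x.
Proof.
move=> K1 x1; rewrite subr_ge0 le_min; apply/andP; split; last by nra.
by move: x1; rewrite negb_and -!leNgt => /orP[h|h]; nra.
Qed.

(** Derivatives are local: near a point of the interval the truncation is inactive, so each
    derivative below is computed on a polynomial that agrees with the function nearby. *)
Lemma near_itvNoo1 (R : realType) (x : R) : -1 < x < 1 -> \near x, -1 < x < 1.
Proof.
by move=> x1; have := @near_in_itvoo R (-1) 1 x; rewrite in_itv/= x1 => /(_ isT).
Qed.

Lemma is_derive_truncated_parabola (R : realType) (K x : R) : 1 <= K -> -1 < x < 1 ->
  is_derive x 1 (truncated_parabola K) (2 * x).
Proof.
move=> K1 x1; apply: (@near_eq_is_derive _ _ _ (fun t : R => t ^+ 2 - 1)).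
  near=> t; rewrite truncated_parabolaE//; near: t; exact: near_itvNoo1.
apply: is_derive_eq.
by rewrite subr0 -[x%:A]/(x * 1) mulr1; ring.
Unshelve. all: by end_near. Qed.

Lemma is_derive1_truncated_parabola (R : realType) (K x : R) : 1 <= K -> -1 < x < 1 ->
  is_derive x 1 (derive1 (truncated_parabola K)) 2.
Proof.
move=> K1 x1; apply: (@near_eq_is_derive _ _ _ (fun t : R => 2 * t)).
  near=> t; rewrite derive1E; apply/esym.
  have [|_ ->//] := @is_derive_truncated_parabola R K t K1.
  near: t; exact: near_itvNoo1.
apply: is_derive_eq.
by rewrite /GRing.scale/= mulr1.
Unshelve. all: by end_near. Qed.

Lemma derive1n2_truncated_parabola (R : realType) (K x : R) : 1 <= K -> -1 < x < 1 ->
  derive1n 2 (truncated_parabola K) x = 2.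
Proof.
move=> K1 x1; rewrite derive1nS derive1n1 derive1E.
by have [_ ->] := is_derive1_truncated_parabola K1 x1.
Qed.

Lemma C2_on_truncated_parabola (R : realType) (K : R) : 1 <= K ->
  C2_on [set x | -1 < x < 1] (truncated_parabola K).
Proof.
move=> K1 x x1; split.
- by have [] := is_derive_truncated_parabola K1 x1.
- by have [] := is_derive1_truncated_parabola K1 x1.
- rewrite /prop_for /continuous_at derive1n2_truncated_parabola//.
  apply: cvg_near_cst; near=> t; apply: derive1n2_truncated_parabola => //.
  near: t; exact: near_itvNoo1.
Unshelve. all: by end_near. Qed.

(** * Second differences and the nonlocal term *)

Definition second_difference (R : realType) (u : R -> R) (x y : R) : R :=
  u (x + y) + u (x - y) - 2 * u x.

(** The sign is reversed so that the new factor is nonnegative for the truncated parabola; the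
    scalar [-1] stays explicit so that linearity of the integral can extract it. At [y = 0] both
    sides vanish. *)
Lemma fracLap_integrandE (R : realType) (s : R) (u : R -> R) (x y : R) :
  fracLap_integrand s u x y
    = -1 * (second_difference u x y * `|y| `^ (- (1 + 2 * s))).
Proof. by rewrite /fracLap_integrand /second_difference powRN; ring. Qed.

(** The difference is a sum of two minima less [2 x^2]. If neither is truncated it equals [2 y^2];
    otherwise one of them is [K^2 >= 9], which outweighs [2 x^2 <= 2]. *)
Lemma second_difference_truncated_parabola_ge0 (R : realType) (K x y : R) :
  3 <= K -> -1 < x < 1 -> 0 <= second_difference (truncated_parabola K) x y.
Proof.
move=> K3 x1; rewrite /second_difference (truncated_parabolaE _ x1)//; last by lra.
case/andP: x1 => x1 x2; rewrite /truncated_parabola.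
have x21 : x ^+ 2 <= 1 by nra.
have K9 : 9 <= K ^+ 2 by nra.
have := sqr_ge0 y; have := sqr_ge0 (x + y); have := sqr_ge0 (x - y).
by case: (lerP ((x + y) ^+ 2) (K ^+ 2)) => h1;
  case: (lerP ((x - y) ^+ 2) (K ^+ 2)) => h2; nra.
Qed.

(** Bounding both minima by their first arguments gives [2 y^2]; by their second,
    [2 K^2 - 2 x^2]. *)
Lemma second_difference_truncated_parabola_le (R : realType) (K x y : R) :
  1 <= K -> -1 < x < 1 ->
  second_difference (truncated_parabola K) x y <= 2 * Num.min (y ^+ 2) (K ^+ 2).
Proof.
move=> K3 x1; rewrite /second_difference (truncated_parabolaE _ x1)//.
have /andP[h1 h2] : (truncated_parabola K (x + y) <= (x + y) ^+ 2 - 1)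
    && (truncated_parabola K (x - y) <= (x - y) ^+ 2 - 1).
  by rewrite !lerD2r !ge_min !lexx.
have /andP[h3 h4] : (truncated_parabola K (x + y) <= K ^+ 2 - 1)
    && (truncated_parabola K (x - y) <= K ^+ 2 - 1).
  by rewrite !lerD2r !ge_min !lexx !orbT.
by case/andP: x1 => x1 x2; case: (lerP (y ^+ 2) (K ^+ 2)) => h5; nra.
Qed.

(** Here [|x + y|] and [|x - y|] are at most [K], so neither value is truncated. *)
Lemma second_difference_truncated_parabolaE (R : realType) (K x y : R) :
  1 <= K -> -1 < x < 1 -> `|y| <= K - 1 ->
  second_difference (truncated_parabola K) x y = 2 * y ^+ 2.
Proof.
move=> K3 x1; rewrite /second_difference (truncated_parabolaE _ x1)//.
case/andP: x1 => x1 x2; rewrite ler_norml => /andP[y1 y2].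
rewrite /truncated_parabola !min_l; first ring; nra.
Qed.

Lemma measurable_second_difference_kernel (R : realType) (r : R) (u : R -> R) (x : R) :
  continuous u ->
  measurable_fun setT (fun y => second_difference u x y * `|y| `^ r).
Proof.
move=> cu; apply: measurable_funM; last first.
  by apply: (measurableT_comp (measurable_powR r)); exact: normr_measurable.
apply: continuous_measurable_fun => y.
have cD : {for y, continuous (fun y => u (x + y))}.
  apply: continuous_comp; last exact: cu.
  by apply: cvgD; [exact: cvg_cst|exact: cvg_id].
have cB : {for y, continuous (fun y => u (x - y))}.
  apply: continuous_comp; last exact: cu.
  by apply: cvgB; [exact: cvg_cst|exact: cvg_id].
by apply: cvgB; [exact: cvgD|exact: cvg_cst].
Qed.

Lemma integrable_second_difference_truncated_parabola (R : realType) (s K x : R) :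
  0 < s -> s < 1 -> 3 <= K -> -1 < x < 1 ->
  lebesgue_measure.-integrable setT
    (EFin \o (fun y => second_difference (truncated_parabola K) x y
                         * `|y| `^ (- (1 + 2 * s)))).
Proof.
move=> s0 s1 K3 x1.
set f := fun y => _.
have mf : measurable_fun setT f.
  apply: measurable_second_difference_kernel; exact: truncated_parabola_continuous.
have K1 : 1 <= K by lra.
have f0 y : `|f y| = f y.
  by rewrite ger0_norm// mulr_ge0 ?powR_ge0 ?second_difference_truncated_parabola_ge0.
have fle y := second_difference_truncated_parabola_le y K1 x1.
apply: even_integrable_setT => //.
  by move=> y; rewrite /f normrN /second_difference opprK [u in u - _]addrC.
(* Near 0 the kernel times [y^2] is [y^(1-2s)], whence [p = 2 - 2s]; at infinity the kernel alone
   gives [q = 2s]. As [K >= 1], the constant [2 K^2] covers both regimes. *)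
apply: (@integrable_powR_dominated _ (2 - 2 * s) (2 * s) (2 * K ^+ 2)) => //.
- by lra.
- by lra.
- move=> t /andP[t0 t1]; rewrite f0 /f gtr0_norm//.
  have -> : 2 - 2 * s - 1 = 2 + - (1 + 2 * s) by ring.
  rewrite powRD ?(gt_eqF t0) ?implybT// powR_mulrn ?(ltW t0)// mulrA ler_wpM2r ?powR_ge0//.
  apply: le_trans (fle t) _.
  rewrite -mulrA ler_wpM2l// ge_min; apply/orP; left.
  by rewrite ler_peMl ?sqr_ge0//; nra.
- move=> t t1; rewrite f0 /f gtr0_norm; last exact: lt_le_trans t1.
  have -> : - (2 * s) - 1 = - (1 + 2 * s) by ring.
  rewrite ler_wpM2r ?powR_ge0//; apply: le_trans (fle t) _.
  by rewrite ler_wpM2l// ge_min lexx orbT.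
Qed.

(* The window [m, 2m] suffices: there the integrand is at least
   [2 m^2 / (2m)^(1+2s) >= m^(1-2s) / 4]. *)
Lemma Rintegral_second_difference_truncated_parabola_ge (R : realType) (s m x : R) :
  0 < s -> s < 1 -> 1 <= m -> -1 < x < 1 ->
  m `^ (2 - 2 * s) / 4 <=
  \int[lebesgue_measure]_(y in [set: R])
    (second_difference (truncated_parabola (2 * m + 1)) x y
       * `|y| `^ (- (1 + 2 * s))).
Proof.
move=> s0 s1 m1 x1; set f := fun y => _.
have m0 : 0 < m by exact: lt_le_trans m1.
have fi := integrable_second_difference_truncated_parabola s0 s1
  (_ : 3 <= 2 * m + 1) x1.
have c0 : 0 <= m `^ (1 - 2 * s) / 4 by rewrite divr_ge0 ?powR_ge0.
have -> : m `^ (2 - 2 * s) / 4 = m `^ (1 - 2 * s) / 4 * (2 * m - m).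
  have -> : 2 - 2 * s = (1 - 2 * s) + 1 by ring.
  rewrite powRD ?(gt_eqF m0) ?implybT// powRr1 ?(ltW m0)//; ring.
apply: Rintegral_ge_cst_itv => //.
- by lra.
- by apply: fi; lra.
- move=> y _; rewrite mulr_ge0 ?powR_ge0//.
  by apply: second_difference_truncated_parabola_ge0 => //; lra.
- move=> y /andP[my ym]; have y0 : 0 < y by exact: lt_le_trans my.
  (* With [K = 2m + 1] the exact formula holds up to [K - 1 = 2m], the right end of the window. *)
  rewrite /f second_difference_truncated_parabolaE//; [|lra|rewrite gtr0_norm//; lra].
  rewrite gtr0_norm//.
  apply: (@le_trans _ _ (2 * m ^+ 2 * (2 * m) `^ (- (1 + 2 * s)))); last first.
    apply: ler_pM; rewrite ?powR_ge0//; [by nra|by nra|].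
    rewrite !powRN lef_pV2 ?posrE ?powR_gt0//; last by lra.
    by apply: ge0_ler_powR; rewrite ?nnegrE; lra.
  have -> : 1 - 2 * s = 2 + - (1 + 2 * s) by ring.
  rewrite powRD ?(gt_eqF m0) ?implybT// powR_mulrn ?(ltW m0)//.
  rewrite powRM ?(ltW m0)//.
  (* The exponent satisfies [1 + 2s <= 3]. *)
  have h : 8^-1 <= (2 : R) `^ (- (1 + 2 * s)).
    have -> : 8^-1 = (2 : R) `^ (- 3) by rewrite powRN powR_mulrn//; congr (_^-1); ring.
    by apply: ler_powR; lra.
  have -> : m ^+ 2 * m `^ (- (1 + 2 * s)) / 4
    = 2 * m ^+ 2 * (8^-1 * m `^ (- (1 + 2 * s))) by field.
  apply: ler_wpM2l; first by rewrite mulr_ge0 ?sqr_ge0.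
  by apply: ler_wpM2r; first exact: powR_ge0.
Qed.

(** * Choice of the truncation level *)

Unset Implicit Arguments.

Theorem mainTheorem4 (R : realType) (s alpha : R)
    (s_gt0 : 0 < s) (s_lt1 : s < 1) (alpha_gt0 : 0 < alpha) :
  let Omega : set R := [set x | -1 < x < 1] in
  exists u : R -> R,
    [/\ continuous u,
        C2_on Omega u,
        (forall x, Omega x ->
           fracLap_defined s u x /\ 0 <= - derive1n 2 u x - alpha * fracLap s u x),
        (forall x, (~` Omega) x -> 0 <= u x) &
        (forall x, Omega x -> u x < 0)].
Proof.
move=> Omega; have c0 := cfrac_gt0 s_gt0 s_lt1.
(* The nonlocal term must reach [u'' = 2]. The integral is at least [m^(2-2s)/4], so [m^(2-2s) >= A]
   suffices; taking the maximum with 1 ensures [K = 2m + 1 >= 3]. *)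
pose A := 8 / (alpha * cfrac s).
have A0 : 0 < A by apply: divr_gt0 => //; exact: mulr_gt0.
pose m := Num.max 1 (A `^ (2 - 2 * s)^-1).
have m1 : 1 <= m by rewrite le_max lexx.
have Am : A <= m `^ (2 - 2 * s).
  have -> : A = (A `^ (2 - 2 * s)^-1) `^ (2 - 2 * s).
    by rewrite -powRrM mulVf ?powRr1 ?(ltW A0)//; lra.
  apply: ge0_ler_powR; rewrite ?nnegrE ?powR_ge0//; [by lra|by lra|].
  by rewrite le_max lexx orbT.
have K1 : 1 <= 2 * m + 1 by lra.
have K3 : 3 <= 2 * m + 1 by lra.
exists (truncated_parabola (2 * m + 1)); split.
- exact: truncated_parabola_continuous.
- exact: C2_on_truncated_parabola.
- move=> x x1.
  have fi := integrable_second_difference_truncated_parabola s_gt0 s_lt1 K3 x1.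
  split.
    rewrite /fracLap_defined; under eq_fun do rewrite fracLap_integrandE EFinM.
    exact: integrableZl.
  rewrite derive1n2_truncated_parabola// /fracLap.
  under eq_Rintegral do rewrite fracLap_integrandE.
  (* Extracting [-1] makes the nonlocal contribution positive; the goal amounts to
     [alpha * cfrac s * I >= 2], with [I] the integral of the second difference against the
     kernel. *)
  rewrite RintegralZl//.
  have := Rintegral_second_difference_truncated_parabola_ge s_gt0 s_lt1 m1 x1.
  set I := (\int[_]_(y in _) _) => I_ge.
  have AI : A / 4 <= I by lra.
  have : alpha * cfrac s * (A / 4) <= alpha * cfrac s * I.
    by rewrite ler_wpM2l// ltW// mulr_gt0.
  have -> : alpha * cfrac s * (A / 4) = 2.
    by rewrite /A; field; rewrite !gt_eqF.
  by lra.
- by move=> x /negP x1; exact: truncated_parabola_ge0.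
- by move=> x x1; exact: truncated_parabola_lt0.
Qed.
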